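(* As $n\to\infty$, $f(n)\le (0.382+o(1))\,n$.
   Context: All graphs are finite, simple and undirected. For a graph $G$ with vertex set $V=V(G)\neq\emptyset$, a set $A\subseteq V$ and a vertex $x$, let $d_A(x)$ denote the number of neighbors of $x$ in $A$. Define $$f(G)=\min\left\{|A|+\left|\{x\in V\setminus A : d_A(x)\text{ is odd}\}\right| : \emptyset\neq A\subseteq V\right\},$$ and, for a positive integer $n$, $$f(n)=\max\{f(G): G \text{ a graph with } |V(G)|=n\}.$$ *)

(* Defs.v *)
From mathcomp Require Import all_boot.

Set Implicit Arguments.
Unset Strict Implicit.
Unset Printing Implicit Defensive.

(* A finite simple undirected graph on the vertex type T is given by its set
   E of edges, which are 2-element subsets of T. *)
Definition simple_graph (T : finType) (E : {set {set T}}) : bool :=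
  [forall B in E, #|B| == 2].

(* No loop is counted: [set x; x] is a singleton, hence never an edge. *)
Definition deg_in (T : finType) (E : {set {set T}}) (A : {set T}) (x : T) : nat :=
  #|[set y in A | [set x; y] \in E]|.

Definition cost (T : finType) (E : {set {set T}}) (A : {set T}) : nat :=
  #|A| + #|[set x | (x \notin A) && odd (deg_in E A x)]|.

(* The seed [set: T] of the arg min satisfies the constraint A != set0 as soon
   as T is inhabited, so that this is the minimum over the nonempty A. *)
Definition f_graph (T : finType) (E : {set {set T}}) : nat :=
  cost E [arg min_(A < [set: T] | A != set0) cost E A].

(* f_graph is invariant under graph isomorphism, so the graphs on n vertices
   may be taken with vertex type 'I_n. *)
Definition f (n : nat) : nat :=
  \max_(E : {set {set 'I_n}} | simple_graph E) f_graph E.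

(* Main.v *)
Require Import Defs.
From mathcomp Require Import all_boot all_order all_algebra.
From mathcomp Require Import all_classical all_reals all_analysis.
From mathcomp Require Import zify lra.

(** The sets [A] of vertices are read as codewords over the four-letter alphabet
    [bool * bool]: the letter of [A] at a vertex [x] records whether [x] lies in
    [A] and the parity of the number of neighbours of [x] in [A].  Parities of
    degrees are additive under symmetric difference, so the Hamming distance of
    the words of [A] and [B] is exactly the cost of their symmetric difference
    ([hamming_parity_word]).  Hence the [2 ^ n] subsets form a code of length
    [n] with minimum distance at least [f_graph E], and the Plotkin bound for
    shortened codes limits this distance.

    Fix a set [S] of [m] vertices, with [m] close to [(n - k) / 2].  All subsets
    of the complement of [S] have the same first bit at each vertex of [S], so by
    the pigeonhole principle at least [2 ^ (n - 2 * m) >= 2 ^ k] of them have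
    words that agree on all of [S].  At each of the other [n - m] positions a
    random pair of these words agrees with probability at least 1/4, by
    Cauchy-Schwarz ([card_collisions]).  So the mean distance is at most
    [3/4 * (n - m)], while it is at least [(1 - 2 ^- k) * f_graph E]
    ([plotkin_bound]).  With [n - m] about [n / 2] this gives
    [f n <= 3/8 * 2 ^ k / (2 ^ k - 1) * n + O(k)]; already [k = 6] brings
    the coefficient of [n] below [0.382], and the bounded remainder is [o(n)]. *)

Set Implicit Arguments.
Unset Strict Implicit.
Unset Printing Implicit Defensive.

Import Order.TTheory GRing.Theory Num.Theory.
Import numFieldNormedType.Exports.

Local Open Scope nat_scope.

(** * The Plotkin bound *)

Lemma sqr_sum_le (I : finType) (u : I -> nat) :
  (\sum_i u i) ^ 2 <= #|I| * \sum_i u i ^ 2.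
Proof.
rewrite -(leq_pmul2l (isT : 0 < 2)).
have -> : 2 * (\sum_i u i) ^ 2 = \sum_i \sum_j 2 * (u i * u j).
  rewrite -mulnn big_distrlr big_distrr /=.
  by apply: eq_bigr => i _; rewrite big_distrr.
have -> : 2 * (#|I| * \sum_i u i ^ 2) = \sum_i \sum_j (u i ^ 2 + u j ^ 2).
  under [RHS]eq_bigr => i _ do rewrite big_split sum_nat_const /=.
  by rewrite big_split sum_nat_const -big_distrr /= mul2n addnn.
by apply: leq_sum => i _; apply: leq_sum => j _; apply: nat_Cauchy.
Qed.

(** The number of ordered pairs in [C] with a collision is the sum of the
    squared fibre sizes, which Cauchy-Schwarz bounds from below. *)
Lemma card_collisions (I Q : finType) (C : {set I}) (g : I -> Q) :
  #|C| ^ 2 <= #|Q| * \sum_(a in C) \sum_(b in C) (g a == g b).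
Proof.
have -> : #|C| = \sum_q #|[set a in C | g a == q]|.
  rewrite -sum1_card (partition_big g predT) //=.
  by apply: eq_bigr => q _; rewrite -sum1_card; apply: eq_bigl => a; rewrite inE.
apply: leq_trans (sqr_sum_le _) _; rewrite leq_mul2l; apply/orP; right.
rewrite [leqRHS](partition_big g predT) //=; apply: leq_sum => q _.
have -> : \sum_(a in C | g a == q) \sum_(b in C) (g a == g b)
        = \sum_(a in C | g a == q) #|[set a in C | g a == q]|.
  apply: eq_bigr => a /andP[_ /eqP <-]; rewrite -big_mkcondr -sum1_card /=.
  by apply: eq_bigl => b; rewrite inE eq_sym.
rewrite sum_nat_const -mulnn leq_mul2r; apply/orP; right.
by apply/eq_leq/eq_card => a; rewrite inE.
Qed.

(** Double counting of the pairwise distances: each position in [D] contributes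
    at most a fraction [(#|Q| - 1) / #|Q|] of the pairs.  A code whose words
    agree outside [D] behaves as a code of length [#|D|]. *)
Lemma plotkin_bound (I T Q : finType) (w : I -> T -> Q) (C : {set I})
    (D : {set T}) (d : nat) :
    (forall a b, a \in C -> b \in C -> a != b ->
       d <= #|[set x | w a x != w b x]|) ->
    (forall a b x, a \in C -> b \in C -> x \notin D -> w a x = w b x) ->
  #|Q| * (d * #|C|.-1) <= #|Q|.-1 * (#|D| * #|C|).
Proof.
move=> dist_ge agree.
have [->|[a0 a0C]] := set_0Vmem C; first by rewrite cards0 !muln0.
have C_gt0 : 0 < #|C| by apply/card_gt0P; exists a0.
pose dist a b := #|[set x | w a x != w b x]|.
pose agr a b := #|[set x in D | w a x == w b x]|.
have distE a b : a \in C -> b \in C -> dist a b + agr a b = #|D|.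
  move=> aC bC; rewrite addnC -(cardsID [set x | w a x == w b x] D).
  congr (_ + _); first by apply: eq_card => x; rewrite !inE.
  apply: eq_card => x; rewrite !inE.
  by have [xD|xD] := boolP (x \in D); rewrite ?andbT // (agree a b) ?eqxx.
pose total := \sum_(a in C) \sum_(b in C) dist a b.
have total_ge : d * (#|C| * #|C|.-1) <= total.
  rewrite mulnCA -sum_nat_const; apply: leq_sum => a aC.
  rewrite (bigD1 a) //= (cardsD1 a C) aC add1n mulnC -sum_nat_const.
  apply: leq_trans (leq_addl _ _).
  rewrite (eq_bigl (fun b => (b \in C) && (b != a))); last first.
    by move=> b; rewrite !inE andbC.
  by apply: leq_sum => b /andP[bC neq_ba]; rewrite dist_ge // eq_sym.
pose total_agr := \sum_(a in C) \sum_(b in C) agr a b.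
have total_eq : total + total_agr = #|D| * #|C| ^ 2.
  rewrite /total /total_agr -big_split /=.
  under eq_bigr => a aC.
    rewrite -big_split /=.
    under eq_bigr => b bC do rewrite distE //.
    over.
  by rewrite !sum_nat_const -mulnn mulnA mulnC.
have agr_ge : #|D| * #|C| ^ 2 <= #|Q| * total_agr.
  have -> : total_agr
          = \sum_(x in D) \sum_(a in C) \sum_(b in C) (w a x == w b x).
    rewrite exchange_big; apply: eq_bigr => a _.
    rewrite exchange_big; apply: eq_bigr => b _ /=.
    rewrite /agr -sum1_card -big_mkcondr /=.
    by apply: eq_bigl => x; rewrite inE.
  rewrite big_distrr -sum_nat_const; apply: leq_sum => x _.
  exact: card_collisions.
rewrite -(leq_pmul2l C_gt0).
(* An empty alphabet leaves no position, and then all distances vanish. *)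
have Q_gt0 : 0 < #|Q| \/ #|D| = 0.
  have [->|[x xD]] := set_0Vmem D; first by right; rewrite cards0.
  by left; apply/card_gt0P; exists (w a0 x).
case: Q_gt0 => [Q_gt0|D0]; last first.
  move: total_ge; suff -> : total = 0 by rewrite leqn0 => /eqP; nia.
  by move: total_eq; rewrite D0; lia.
have -> : #|C| * (#|Q|.-1 * (#|D| * #|C|))
        = #|Q| * (#|D| * #|C| ^ 2) - #|D| * #|C| ^ 2.
  by rewrite -mulnn -{2}(prednK Q_gt0); nia.
by rewrite -total_eq in agr_ge *; nia.
Qed.

Lemma pigeonhole (I J : finType) (h : I -> J) (C : {set I}) (D : {set J})
    (k : nat) :
    (forall a, a \in C -> h a \in D) -> #|D| * k < #|C| ->
  exists j, k < #|[set a in C | h a == j]|.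
Proof.
move=> hD; apply: contraPP => no_j; apply/negP; rewrite -leqNgt.
rewrite -sum1_card (partition_big h (mem D)) //= -sum_nat_const.
apply: leq_sum => j _; rewrite leqNgt; apply/negP => lt_k; apply: no_j.
exists j; apply: leq_trans lt_k _; rewrite -sum1_card.
by apply/eq_leq/eq_bigl => a; rewrite inE.
Qed.

(** * The parity code of a graph *)

Section ParityCode.

(* Restores the finite meaning of names such as [set0] and [setIC]. *)
Import boot.finset.

Variables (T : finType) (E : {set {set T}}).
Implicit Types A B S : {set T}.

Definition symdiff A B := (A :\: B) :|: (B :\: A).

Definition parity_word A (x : T) : bool * bool :=
  (x \in A, odd (deg_in E A x)).

Lemma in_symdiff A B x : (x \in symdiff A B) = (x \in A) (+) (x \in B).
Proof. by rewrite !inE; case: (x \in A); case: (x \in B). Qed.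

(** A neighbour lying in both [A] and [B] is counted twice on the right, hence
    does not affect the parity. *)
Lemma odd_deg_symdiff A B x :
  odd (deg_in E (symdiff A B) x) = odd (deg_in E A x) (+) odd (deg_in E B x).
Proof.
pose N := [set y | [set x; y] \in E].
have degE C : deg_in E C x = #|C :&: N| by apply: eq_card => y; rewrite !inE.
rewrite !degE -(cardsID B (A :&: N)) -(cardsID A (B :&: N)).
have -> : symdiff A B :&: N = (A :&: N) :\: B :|: (B :&: N) :\: A.
  apply/setP => y; rewrite !inE.
  by case: (y \in A); case: (y \in B); case: (_ \in E).
rewrite cardsU; set I := _ :&: (_ :\: A).
have -> : I = set0.
  apply/setP => y; rewrite !inE.
  by case: (y \in A); case: (y \in B); case: (_ \in E).
have -> : B :&: N :&: A = A :&: N :&: B by rewrite setIC setIAC setIA.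
rewrite cards0 subn0 !oddD.
by case: (odd #|A :&: N :&: B|); rewrite ?addTb ?addFb ?addbN ?addNb ?negbK.
Qed.

(** On the symmetric difference the first bits differ; elsewhere the words
    differ exactly where the second bits do, and there the parity bits sum to
    the parity of the degree into the symmetric difference. *)
Lemma hamming_parity_word A B :
  #|[set x | parity_word A x != parity_word B x]| = cost E (symdiff A B).
Proof.
rewrite /cost -(cardsID (symdiff A B) [set x | _ != _]).
congr (_ + _); apply: eq_card => x; rewrite !inE -?in_symdiff xpair_eqE.
  by case: (x \in A); case: (x \in B); rewrite ?andbF ?andbT.
rewrite odd_deg_symdiff.
by case: (x \in A); case: (x \in B) => //=; rewrite -negb_eqb ?negbK.
Qed.

Lemma f_graph_le_cost A : A != set0 -> f_graph E <= cost E A.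
Proof.
move=> A_neq0; rewrite /f_graph; case: arg_minnP => [|B _]; last exact.
by apply: contraNneq A_neq0 => T0; rewrite -subset0 -T0 subsetT.
Qed.

Lemma f_graph_le_card : 0 < #|T| -> f_graph E <= #|T|.
Proof.
move=> T_gt0; have := @f_graph_le_cost [set: T].
rewrite -cards_eq0 cardsT -lt0n T_gt0 /cost cardsT => /(_ isT).
by rewrite (_ : [set x | _] = set0) ?cards0 ?addn0 //; apply/setP => x; rewrite !inE.
Qed.

Lemma parity_word_dist A B : A != B ->
  f_graph E <= #|[set x | parity_word A x != parity_word B x]|.
Proof.
move=> neq_AB; rewrite hamming_parity_word; apply: f_graph_le_cost.
apply: contraNneq neq_AB => AB0; apply/eqP/setP => x.
by move/setP/(_ x): AB0; rewrite in_symdiff in_set0; case: (x \in A); case: (x \in B).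
Qed.

(** The size of [S] is chosen so that [2 ^ k] words survive the shortening,
    while the remaining length is as close to [#|T| / 2] as parity allows. *)
Lemma f_graph_le k : k <= #|T| ->
  8 * (2 ^ k).-1 * f_graph E <= 3 * 2 ^ k * (#|T| + k + 1).
Proof.
move=> le_kT; pose m := (#|T| - k)./2.
have Em : odd (#|T| - k) + m.*2 = #|T| - k by rewrite odd_double_half.
have [S _ cardS] : exists2 S : {set T}, S \subset [set: T] & #|S| = m.
  have : 0 < #|[set S : {set T} | S \subset [set: T] & #|S| == m]|.
    by rewrite cards_draws bin_gt0 cardsT; lia.
  by case/card_gt0P => S; rewrite inE => /andP[sST /eqP cS]; exists S.
have cardSC : #|~: S| = #|T| - m by rewrite -(cardsC S) cardS addKn.
pose odd_in A := [set x in S | odd (deg_in E A x)].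
have K_gt0 : 0 < 2 ^ k by rewrite expn_gt0.
have [||P fibre_gt] := @pigeonhole _ _ odd_in (powerset (~: S)) (powerset S)
  (2 ^ k).-1.
- by move=> A _; rewrite powersetE; apply/fintype.subsetP => x; rewrite inE => /andP[].
- rewrite !card_powerset cardSC cardS.
  apply: (@leq_trans (2 ^ m * 2 ^ k)); last by rewrite -expnD leq_pexp2l //; lia.
  by rewrite ltn_pmul2l ?expn_gt0 // ltn_predL.
set C := [set A in _ | _] in fibre_gt.
have agree A B x : A \in C -> B \in C -> x \notin ~: S ->
    parity_word A x = parity_word B x.
  rewrite !inE negbK => /andP[AS /eqP EA] /andP[BS /eqP EB] xS.
  have out (D : {set T}) : D \subset ~: S -> x \notin D.
    by move=> DS; apply/negP => /(fintype.subsetP DS); rewrite inE xS.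
  rewrite /parity_word (negPf (out _ AS)) (negPf (out _ BS)).
  congr (_, _); have /setP/(_ x) : odd_in A = odd_in B by rewrite EA EB.
  by rewrite !inE xS.
have := plotkin_bound (fun A B _ _ => @parity_word_dist A B) agree.
rewrite card_prod card_bool cardSC /=.
move: fibre_gt; move: #|C| (f_graph E) => M d; rewrite (prednK K_gt0).
move: (2 ^ k) K_gt0 => K K_gt0 le_KM.
have le_len : 2 * (#|T| - m) <= #|T| + k + 1 by lia.
move: (#|T| - m) (#|T| + k + 1) le_len => N L le_NL bound.
(* Replacing the fibre size M by its lower bound K only weakens the bound, as
   M / (M - 1) decreases with M. *)
have step : 4 * d * K.-1 <= 3 * N * K.
  case: K M K_gt0 le_KM bound => [//|K] [//|M] _ /= le_KM bound.
  case: (posnP M) => [M0|M_gt0]; first by have ->: K = 0; lia.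
  by rewrite -(leq_pmul2r M_gt0); nia.
nia.
Qed.

End ParityCode.

(** The choice [k = 6] is the smallest for which the slope
    [3/8 * 2 ^ k / (2 ^ k - 1)] is below [0.382]. *)
Lemma f_le_linear n : 6 <= n -> 504 * f n <= 192 * (n + 7).
Proof.
move=> le_6n; rewrite /f; elim/big_ind: _ => [//|u v|E _]; first by lia.
by have := @f_graph_le _ E 6; rewrite card_ord => /(_ le_6n); lia.
Qed.

Lemma f_le_id n : 0 < n -> f n <= n.
Proof.
move=> n_gt0; apply/bigmax_leqP => E _.
by rewrite -[leqRHS]card_ord f_graph_le_card ?card_ord.
Qed.

Local Open Scope classical_set_scope.
Local Open Scope ring_scope.

Theorem theorem1p2 (R : realType) :
  exists2 o1 : nat -> R, o1 @ \oo --> (0 : R) &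
    forall n : nat, (0 < n)%N -> (f n)%:R <= (382 / 1000 + o1 n) * n%:R :> R.
Proof.
(* The constant 6 covers both the remainder 192 * 7 / 504 of the linear bound
   and the trivial bound f n <= n for n < 6. *)
exists (fun n => 6 / n%:R).
  rewrite -[X in _ --> X](mulr0 6); apply: cvgMl_tmp.
  rewrite gtr0_cvgV0; first exact: cvgr_idn.
  by near=> n; rewrite ltr0n; near: n; exact: nbhs_infty_gt.
move=> n n_gt0; have n_neq0 : n%:R != 0 :> R by rewrite pnatr_eq0 -lt0n.
rewrite mulrDl divfK //.
have n_ge0 : 0 <= n%:R :> R by [].
have [le_6n|lt_n6] := leqP 6 n.
  have : (504 * f n)%:R <= (192 * (n + 7))%:R :> R by rewrite ler_nat f_le_linear.
  by rewrite !natrM natrD; lra.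
have : (f n)%:R <= 6%:R :> R.
  by rewrite ler_nat (leq_trans (f_le_id n_gt0)) // ltnW.
by lra.
Unshelve. all: by end_near. Qed.
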